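(* Let $m\ge 1$ and $n>2$ be integers, and let $D_{2n}=\langle x,y \mid x^n=y^2=(xy)^2=1\rangle$ be the dihedral group with $2n$ elements. The set of inner derivations of $\mathbb{F}_{2^m} D_{2n}$ is an $\mathbb{F}_{2^m}$-vector space with dimension $3\left\lfloor\frac{n-1}{2}\right\rfloor$ and basis $$\left\{d_b \;\middle|\; b \in \left\{x^i \mid i=1, 2, \dots, \left\lfloor\tfrac{n-1}{2}\right\rfloor\right\} \cup \left\{x^iy \mid i = 0, 1,\dots,2\left\lfloor\tfrac{n-1}{2}\right\rfloor-1\right\}\right\}.$$
   Context: $\mathbb{F}_{2^m}D_{2n}$ is the group algebra of $D_{2n}$ over the finite field with $2^m$ elements. For an element $b$ of a ring $A$, $d_b\colon A\to A$ is the map $d_b(a)=ab-ba$; a derivation $d$ of $A$ is inner if $d=d_b$ for some $b\in A$. The vector space structure is given by pointwise addition and scalar multiplication of maps. *)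

(* Defs.v *)
From HB Require Import structures.
From mathcomp Require Import all_boot all_order all_algebra.
From mathcomp Require Import all_fingroup all_solvable all_field.

Set Implicit Arguments.
Unset Strict Implicit.
Unset Printing Implicit Defensive.

Import GRing.Theory.
Local Open Scope ring_scope.

(* [x] and [y] are the canonical generators of a group presented by
   < x, y | x^n = y^2 = (xy)^2 = 1 >.  MathComp's [\isog Grp] only says that
   the group is isomorphic to the (finite) presented group, without naming the
   generators.  The remaining clauses then pin down [x] and [y]: in a finite
   group, any generating pair that satisfies the relators is the image of the
   canonical pair under an automorphism. *)
Definition dihedral_presentation (n : nat) (gT : finGroupType) (x y : gT) :=
  [/\ ([set: gT] \isog Grp (a : b : a ^+ n, b ^+ 2, (a * b) ^+ 2))%g,
      <<[set x; y]>>%g = [set: gT],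
      (x ^+ n = 1)%g,
      (y ^+ 2 = 1)%g
    & ((x * y) ^+ 2 = 1)%g].

(* The group algebra F[gT].  A type alias is needed because {ffun gT -> F}
   already carries the pointwise product. *)
Definition groupAlg (F : fieldType) (gT : finGroupType) : Type :=
  {ffun gT -> F}.

Section GroupAlgebra.
Variables (F : fieldType) (gT : finGroupType).
Local Notation A := (groupAlg F gT).

HB.instance Definition _ := GRing.Lmodule.copy A {ffun gT -> F^o}.
HB.instance Definition _ := Vector.copy A {ffun gT -> F^o}.

Definition gelem (g : gT) : A := [ffun h => (h == g)%:R].

Definition gmul (a b : A) : A := [ffun g => \sum_h a h * b (h^-1 * g)%g].

Fact gmulA : associative gmul.
Proof.
move=> a b c; apply/ffunP=> g; rewrite !ffunE.
under eq_bigr => h _ do rewrite ffunE big_distrr /=.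
under [RHS]eq_bigr => h _ do rewrite ffunE big_distrl /=.
rewrite [RHS]exchange_big /=; apply: eq_bigr => h _.
rewrite [RHS](reindex_inj (mulgI h)) /=; apply: eq_bigr => k _.
by rewrite mulKg invMg -mulgA mulrA.
Qed.

Fact gmul1l : left_id (gelem 1%g) gmul.
Proof.
move=> a; apply/ffunP=> g; rewrite ffunE (bigD1 1%g) //= big1 => [|h /negPf nh].
  by rewrite ffunE eqxx mul1r addr0 invg1 mul1g.
by rewrite ffunE nh mul0r.
Qed.

Fact gmul1r : right_id (gelem 1%g) gmul.
Proof.
move=> a; apply/ffunP=> g; rewrite ffunE (bigD1 g) //= big1 => [|h nh].
  by rewrite ffunE mulVg eqxx mulr1 addr0.
by rewrite ffunE -eq_invg_mul invgK (negPf nh) mulr0.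
Qed.

Fact gmulDl : left_distributive gmul +%R.
Proof.
move=> a b c; apply/ffunP=> g; rewrite !ffunE -big_split /=.
by apply: eq_bigr => h _; rewrite ffunE mulrDl.
Qed.

Fact gmulDr : right_distributive gmul +%R.
Proof.
move=> a b c; apply/ffunP=> g; rewrite !ffunE -big_split /=.
by apply: eq_bigr => h _; rewrite ffunE mulrDr.
Qed.

Fact gelem1_neq0 : gelem 1%g != 0.
Proof.
by apply/eqP=> /ffunP/(_ 1%g); rewrite !ffunE eqxx => /eqP; rewrite oner_eq0.
Qed.

HB.instance Definition _ := GRing.Zmodule_isNzRing.Build A
  gmulA gmul1l gmul1r gmulDl gmulDr gelem1_neq0.

Fact gscaleAl (k : F) (a b : A) : k *: (a * b) = (k *: a) * b.
Proof.
apply/ffunP=> g; rewrite !ffunE scaler_sumr.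
by apply: eq_bigr => h _; rewrite ffunE; apply: mulrA.
Qed.

HB.instance Definition _ := GRing.Lmodule_isLalgebra.Build F A gscaleAl.

Fact gscaleAr (k : F) (a b : A) : k *: (a * b) = a * (k *: b).
Proof.
apply/ffunP=> g; rewrite !ffunE scaler_sumr.
by apply: eq_bigr => h _; rewrite ffunE; apply: mulrCA.
Qed.

HB.instance Definition _ := GRing.Lalgebra_isAlgebra.Build F A gscaleAr.

End GroupAlgebra.

HB.instance Definition _ (F : finFieldType) (gT : finGroupType) :=
  Finite.copy (groupAlg F gT) {ffun gT -> F}.

Definition derivation (A : nzRingType) (d : A -> A) :=
  {morph d : a b / a + b} /\ forall a b, d (a * b) = d a * b + a * d b.

Definition dmap (A : nzRingType) (b : A) : A -> A := fun a => a * b - b * a.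

Definition inner_derivation (A : nzRingType) (d : A -> A) :=
  derivation d /\ exists b : A, d =1 dmap b.

(* Main.v *)
Require Import Defs.
From HB Require Import structures.
From mathcomp Require Import all_boot all_order all_algebra.
From mathcomp Require Import all_fingroup all_solvable all_field.
From mathcomp Require Import zify.

Set Implicit Arguments.
Unset Strict Implicit.
Unset Printing Implicit Defensive.

Import GRing.Theory.
Local Open Scope ring_scope.

(** For any finite group [G], the map [b |-> d_b] is linear, and its kernel is
    the centre of the group algebra, that is, the space of functions on [G] that
    are constant on conjugacy classes ([inner_der_eq0P]).  Fix a transversal [T]
    of the conjugacy classes.  A class function is determined by its values on
    [T], and these values are arbitrary; so the functions supported off [T] form
    a complement of the kernel, and the [d_g] with [g] outside [T] are a basis
    of the image ([inner_der_basis]).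

    In the dihedral group, conjugation turns [x ^+ i] into [x ^+ i] or
    [x ^- i], and [x ^+ i * y] into [x ^+ j * y], where [j - i] runs over the even
    integers modulo [n]: the reflections form one class if [n] is odd, and two
    classes, told apart by the parity of the exponent, if [n] is even.
    Let [k] be the integer part of [(n - 1) / 2].  The elements missing from the
    proposed list are [1], the [x ^+ i] with [k < i < n] (one of each pair
    [x ^+ i], [x ^- i], and the central involution if [n] is even), and the
    [x ^+ i * y] with [2 * k <= i < n] (one reflection if [n] is odd, two of
    different parities if [n] is even).  They form a transversal:
    [dihedral_class_meets] and [dihedral_class_once].

    This uses that the [x ^+ i] and [x ^+ i * y] with [i < n] are [2 * n]
    distinct elements.  The relations give at most [2 * n] elements, and the
    universal property of the presentation maps the group onto the concrete
    dihedral group of order [2 * n] ([dihedral_card], [dihedral_cycles]). *)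

(** * Inner derivations of a group algebra *)

Lemma dmap_derivation (A : nzRingType) (b : A) : derivation (dmap b).
Proof.
split=> [a c | a c]; rewrite /dmap; first by rewrite mulrDl mulrDr opprD addrACA.
by rewrite mulrBl mulrBr !mulrA [RHS]addrC addrA subrK.
Qed.

Section InnerDerivations.
Variables (F : finFieldType) (gT : finGroupType).
Local Notation A := (groupAlg F gT).

Definition inner_der (b : A) : {ffun A -> A} := finfun (dmap b).

Fact inner_der_linear : linear inner_der.
Proof.
move=> k b c; apply/ffunP=> a; rewrite !ffunE /dmap.
by rewrite mulrDl mulrDr -scalerAl -scalerAr scalerBr opprD addrACA.
Qed.

HB.instance Definition _ :=
  GRing.isLinear.Build F A {ffun A -> A} _ inner_der inner_der_linear.

Lemma gelem_expansion (a : A) : a = \sum_g a g *: gelem F g.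
Proof.
apply/ffunP=> h; rewrite sum_ffunE (bigD1 h) //= !ffunE eqxx big1 ?addr0.
  by rewrite /GRing.scale /= mulr1.
by move=> g /negPf nhg; rewrite !ffunE eq_sym nhg scaler0.
Qed.

(** Commuting with the single group element [h] already says that [c] is
    invariant under conjugation by [h]: evaluate [h * c = c * h] at [g * h].
    The converse is a change of summation variable in the convolution. *)
Lemma inner_der_eq0P (c : A) :
  inner_der c = 0 <-> forall g h : gT, c (g ^ h)%g = c g.
Proof.
split=> [Dc0 g h | cJ].
  have /ffunP/(_ (g * h)%g) : dmap c (gelem F h) = 0.
    by have /ffunP/(_ (gelem F h)) := Dc0; rewrite !ffunE.
  rewrite /dmap !ffunE (bigD1 h) //= big1 => [|j /negPf njh]; last first.
    by rewrite ffunE njh mul0r.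
  rewrite (bigD1 g) //= [X in _ - (_ + X)]big1 => [|j njg]; last first.
    rewrite ffunE -(inj_eq (mulgI j)) mulKVg (inj_eq (mulIg h)).
    by rewrite eq_sym (negPf njg) mulr0.
  rewrite !ffunE eqxx mulKg eqxx !addr0 mul1r mulr1 -conjgE.
  by move/eqP; rewrite subr_eq0 => /eqP.
apply/ffunP=> a; rewrite !ffunE; apply/ffunP=> g; rewrite !ffunE.
apply/eqP; rewrite subr_eq0; apply/eqP.
rewrite [RHS](reindex_inj invg_inj) [RHS](reindex_inj (mulIg g^-1%g)) /=.
apply: eq_bigr => h _.
rewrite invgK invMg invgK mulgKV [LHS]mulrC; congr (_ * _).
by rewrite -(cJ (g * h^-1)%g h) conjgE mulgKV.
Qed.

Lemma inner_derivationP (f : {ffun A -> A}) :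
  f \in limg (linfun inner_der) <-> inner_derivation f.
Proof.
split=> [/memv_imgP[b _ ->] | [_ [b fb]]].
  rewrite lfunE; split; last by exists b => a; rewrite ffunE.
  have [dD dM] := dmap_derivation b.
  by split=> a c; rewrite !ffunE ?dD ?dM.
apply/memv_imgP; exists b; first exact: memvf.
by rewrite lfunE; apply/ffunP=> a; rewrite ffunE fb.
Qed.

(** The last two hypotheses say that the complement of [s] is a transversal of
    the conjugacy classes.  Spanning: subtracting from [a] the class function
    with the same values on the transversal leaves [d_a] unchanged and makes [a]
    supported on [s].  Freeness: a class function supported on [s] vanishes on
    the transversal, hence everywhere. *)
Lemma inner_der_basis (s : seq gT) :
    uniq s ->
    (forall g, exists h, (g ^ h)%g \notin s) ->
    (forall t h, t \notin s -> (t ^ h)%g \notin s -> (t ^ h)%g = t) ->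
  basis_of (limg (linfun inner_der)) [seq inner_der (gelem F g) | g <- s].
Proof.
move=> Us meets once.
(* [g ^ r g] is the representative of the class of [g] in the transversal. *)
have [r rP] : exists r : gT -> gT, forall g, (g ^ r g)%g \notin s.
  by apply: (fin_all_exists meets).
apply/andP; split.
  rewrite eqEsubv; apply/andP; split.
    apply/span_subvP=> _ /mapP[g _ ->]; apply/memv_imgP.
    by exists (gelem F g); rewrite ?memvf ?lfunE.
  apply/subvP=> _ /memv_imgP[a _ ->]; rewrite lfunE /=.
  pose c : A := [ffun g => a (g ^ r g)%g].
  have Dc0 : inner_der c = 0.
    apply/inner_der_eq0P=> g h; rewrite !ffunE; congr (a _).
    have E : ((g ^ h) ^ r (g ^ h)%g = (g ^ r g) ^ ((r g)^-1 * h * r (g ^ h)))%g.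
      by rewrite -!conjgM !mulgA mulgV mul1g.
    by rewrite E; apply: once; rewrite -?E rP.
  have -> : inner_der a = inner_der (a - c) by rewrite linearB /= Dc0 subr0.
  rewrite [a - c]gelem_expansion linear_sum /=; apply: memv_suml => g _.
  rewrite linearZ /=; have [gs | ngs] := boolP (g \in s).
    by apply/memvZ/memv_span/map_f.
  by rewrite !ffunE once ?rP // subrr scale0r mem0v.
pose X := [tuple of [seq inner_der (gelem F g) | g <- in_tuple s]].
suff: free X by []; apply/freeP=> k; pose e (i : 'I_(size s)) := nth 1%g s i.
have De (i : 'I_(size s)) : X`_i = inner_der (gelem F (e i)).
  by rewrite (nth_map 1%g).
under eq_bigr do rewrite De -linearZ /=.
rewrite -linear_sum /= => /inner_der_eq0P cJ i.
set c := \sum_j _ in cJ.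
have cE g : c g = \sum_j k j * (g == e j)%:R.
  by rewrite sum_ffunE; apply: eq_bigr => j _; rewrite !ffunE.
have c0 g : c g = 0.
  have [h] := meets g; rewrite -(cJ g h) cE => nsgh.
  apply: big1 => j _; case: eqP => [gh|]; last by rewrite mulr0.
  by rewrite gh mem_nth in nsgh.
have := c0 (e i); rewrite cE (bigD1 i) //= eqxx mulr1 big1 ?addr0 // => j nji.
by rewrite nth_uniq // eq_sym (inj_eq val_inj) (negPf nji) mulr0.
Qed.
End InnerDerivations.

(** * Conjugacy in the dihedral group *)

Section Dihedral.
Local Open Scope group_scope.
Variables (n : nat) (gT : finGroupType) (x y : gT).
Hypotheses (hn : (2 < n)%N) (hD : dihedral_presentation n x y).

Lemma dihedral_reflV : y^-1 = y.
Proof.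
by have [_ _ _ y2 _] := hD; apply/eqP; rewrite eq_invg_mul -expg2 y2.
Qed.

Lemma dihedral_conj i : (x ^+ i) ^ y = x ^- i.
Proof.
case: hD => _ _ _ _ xy2; rewrite conjXg -expgVn; congr (_ ^+ _).
by apply: (mulgI x); rewrite mulgV conjgE dihedral_reflV mulgA -expg2.
Qed.

Lemma dihedral_refl_rot i : y * x ^+ i = x ^- i * y.
Proof.
have [_ _ _ y2 _] := hD.
by rewrite -dihedral_conj conjgE dihedral_reflV -!mulgA -expg2 y2 mulg1.
Qed.

(** The universal property of the presentation provides a surjection onto the
    dihedral group ['D_n.*2], because the generators of the latter, which
    satisfy [a ^ b = a^-1], also satisfy [(a * b) ^+ 2 = 1]. *)
Lemma dihedral_card : (2 * n %| #|gT|)%N.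
Proof.
case: hD => isoG _ _ _ _.
have n1 : (1 < n)%N by lia.
rewrite -cardsT mul2n -(card_dihedral n1); apply: card_homg.
rewrite isoG.
have := Grp_dihedral n1 [set: 'D_n.*2]%G; rewrite homg_refl => /esym.
move=> /existsP[[a b]] /= /eqP[def an b2 ab]; apply/existsP; exists (a, b) => /=.
have ab2 : (a * b) ^+ 2 = 1.
  by rewrite expg2 {2}(conjgC a b) ab mulgA -(mulgA a) -expg2 b2 mulg1 mulgV.
by rewrite /= def an b2 ab2.
Qed.

(** The group is the product of the two cycles, whose orders are at most [n] and
    [2]; since it has at least [2 * n] elements, nothing can collapse. *)
Lemma dihedral_cycles :
  [/\ #[x] = n, #[y] = 2, <[x]> :&: <[y]> = 1 & <[x]> * <[y]> = [set: gT]].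
Proof.
case: (hD) => _ genG xn y2 _.
have nxy : <[y]> \subset 'N(<[x]>).
  by rewrite norms_cycle -[x]expg1 dihedral_conj groupV mem_cycle.
have defG : <[x]> * <[y]> = [set: gT].
  by rewrite -norm_joinEr // joing_idl joing_idr.
have le_x : (#[x] <= n)%N by rewrite dvdn_leq ?order_dvdn ?xn //; lia.
have le_y : (#[y] <= 2)%N by rewrite dvdn_leq ?order_dvdn ?y2.
have le_G : (2 * n <= #|gT|)%N by rewrite dvdn_leq ?dihedral_card -?cardsT.
have mulG := mul_cardG <[x]> <[y]>; rewrite defG cardsT -!orderE in mulG.
have [ox oy oI] : [/\ #[x] = n, #[y] = 2 & #|<[x]> :&: <[y]>| = 1%N].
  move: le_x le_y le_G mulG (cardG_gt0 (<[x]> :&: <[y]>)).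
  move: #[x] #[y] #|_| #|_ :&: _| hn => a b N l n2 a_n b2 n_N ab l0.
  have ab_n : (a * b = n * 2)%N.
    by have := leq_mul a_n b2; have := leq_pmulr N l0; lia.
  have l1 : l = 1%N by nia.
  have b_2 : b = 2 by nia.
  by split; nia.
by split=> //; apply: card1_trivg.
Qed.

Lemma dihedral_rot_eq i j : (x ^+ i == x ^+ j) = (i == j %[mod n]).
Proof. by case: dihedral_cycles => <- _ _ _; rewrite eq_expg_mod_order. Qed.

Lemma dihedral_rot_neq_refl i j : (x ^+ i == x ^+ j * y) = false.
Proof.
case: dihedral_cycles => _ oy tiI _; apply/eqP=> E.
have : y \in <[x]> :&: <[y]>.
  by rewrite inE cycle_id andbT -(mulKg (x ^+ j) y) -E groupM ?groupV ?mem_cycle.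
by rewrite tiI inE => /eqP y1; rewrite y1 order1 in oy.
Qed.

Variant dihedral_spec : gT -> Prop :=
  | DihedralRot i of (i < n)%N : dihedral_spec (x ^+ i)
  | DihedralRefl i of (i < n)%N : dihedral_spec (x ^+ i * y).

Lemma dihedralP g : dihedral_spec g.
Proof.
case: (dihedral_cycles) => ox oy _ defG.
have : g \in <[x]> * <[y]> by rewrite defG.
case/mulsgP=> _ _ /cyclePmin[i lt_in ->] /cyclePmin[j lt_j ->] ->.
rewrite ox in lt_in; rewrite oy in lt_j.
case: j lt_j => [|[|//]] _; first by rewrite expg0 mulg1; constructor.
by rewrite expg1; constructor.
Qed.

Lemma dihedral_rot_inv i : (i <= n)%N -> x ^- i = x ^+ (n - i).
Proof.
move=> le_in; have [_ _ xn _ _] := hD.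
by apply/eqP; rewrite eq_invg_mul -expgD subnKC // xn.
Qed.

Lemma dihedral_rotJ i h : (i <= n)%N ->
  (x ^+ i) ^ h = x ^+ i \/ (x ^+ i) ^ h = x ^+ (n - i).
Proof.
move=> le_in; have rotJ j : (x ^+ i) ^ (x ^+ j) = x ^+ i.
  by rewrite conjgE -expgD addnC expgD mulKg.
case/dihedralP: h => j _; rewrite ?conjgM rotJ; first by left.
by right; rewrite dihedral_conj dihedral_rot_inv.
Qed.

Lemma dihedral_reflJ_rot i j : (x ^+ (i + 2 * j) * y) ^ (x ^+ j) = x ^+ i * y.
Proof.
rewrite conjgE -mulgA dihedral_refl_rot mul2n -addnn addnCA !expgD.
by rewrite !mulgA mulVg mul1g mulgK.
Qed.

(** For odd [n] the exponent [j] carries no parity, since it only matters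
    modulo [n]. *)
Lemma dihedral_reflJ i h : exists2 j,
  (x ^+ i * y) ^ h = x ^+ j * y & ~~ odd n -> odd j = odd i.
Proof.
have [_ _ xn _ _] := hD.
have rotJ j : (x ^+ i * y) ^ (x ^+ j) = x ^+ (i + 2 * (j * n.-1)) * y.
  (* [i] is replaced by [i + 2 * j * n], to allow subtracting [2 * j]. *)
  rewrite -[RHS](dihedral_reflJ_rot _ j) -addnA -mulnDr -mulnSr prednK; last by lia.
  by rewrite mulnA mulnC expgD expgM xn expg1n mulg1.
case/dihedralP: h => j _; rewrite ?conjgM rotJ.
  by eexists => // _; rewrite oddD mul2n odd_double addbF.
set l := (i + _)%N; exists (l * n.-1)%N.
  rewrite conjMg dihedral_conj conjgE mulKg; congr (_ * _).
  apply/eqP; rewrite eq_invg_mul -expgD -mulnS prednK; last by lia.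
  by rewrite mulnC expgM xn expg1n.
move=> even_n; rewrite oddM oddD mul2n odd_double addbF.
by case: (n) hn even_n => //= n' _; rewrite negbK => ->; rewrite andbT.
Qed.

(** The complement of a transversal of the conjugacy classes, as shown by
    [dihedral_class_meets] and [dihedral_class_once]. *)
Definition nonrepresentatives : seq gT :=
  [seq x ^+ i | i <- iota 1 ((n - 1) %/ 2)] ++
  [seq x ^+ i * y | i <- iota 0 (2 * ((n - 1) %/ 2))].
Local Notation k := ((n - 1) %/ 2)%N.

Lemma mem_dihedral_rot i :
  (i < n)%N -> (x ^+ i \in nonrepresentatives) = (0 < i <= k)%N.
Proof.
move=> lt_in; rewrite mem_cat [X in _ || X](_ : _ = false) ?orbF; last first.
  by apply/negP=> /mapP[j _ /eqP]; rewrite dihedral_rot_neq_refl.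
apply/mapP/idP=> [[j] | i_k]; last by exists i => //; rewrite mem_iota; lia.
rewrite mem_iota => j_k /eqP; rewrite dihedral_rot_eq !modn_small; lia.
Qed.

Lemma mem_dihedral_refl i :
  (i < n)%N -> (x ^+ i * y \in nonrepresentatives) = (i < 2 * k)%N.
Proof.
move=> lt_in; rewrite mem_cat [X in X || _](_ : _ = false) ?orFb; last first.
  by apply/negP=> /mapP[j _ /eqP]; rewrite eq_sym dihedral_rot_neq_refl.
apply/mapP/idP=> [[j] | i_k]; last by exists i => //; rewrite mem_iota; lia.
rewrite mem_iota => j_k /mulIg/eqP; rewrite dihedral_rot_eq !modn_small; lia.
Qed.

Lemma nonrepresentatives_uniq : uniq nonrepresentatives.
Proof.
rewrite cat_uniq !map_inj_in_uniq ?iota_uniq ?andbT /=; first last.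
- move=> i j; rewrite !mem_iota => i_k j_k /eqP.
  by rewrite dihedral_rot_eq !modn_small; lia.
- move=> i j; rewrite !mem_iota => i_k j_k /mulIg/eqP.
  by rewrite dihedral_rot_eq !modn_small; lia.
apply/hasPn=> _ /mapP[j _ ->]; apply/negP=> /mapP[i _ /eqP].
by rewrite eq_sym dihedral_rot_neq_refl.
Qed.

Lemma dihedral_class_meets g : exists h, g ^ h \notin nonrepresentatives.
Proof.
case/dihedralP: g => i lt_in.
  have [i_k | nik] := boolP (0 < i <= k)%N; last first.
    by exists 1; rewrite conjg1 mem_dihedral_rot.
  exists y; rewrite dihedral_conj dihedral_rot_inv 1?ltnW //.
  by rewrite mem_dihedral_rot; lia.
suff [j [l [lt_l le_kl eq_l]]] : exists j l,
    [/\ l < n, 2 * k <= l & i + 2 * j = l %[mod n]]%N.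
  exists (x ^- j); have := dihedral_reflJ_rot i j.
  move/(canRL (conjgK _)) <-.
  have /eqP -> : x ^+ (i + 2 * j) == x ^+ l by rewrite dihedral_rot_eq eq_l.
  by rewrite mem_dihedral_refl // -leqNgt.
have [le_ki | lt_ik] := leqP (2 * k) i.
  by exists 0, i; split; rewrite ?addn0.
(* [l] is the largest or second largest exponent, [2 * k] or [2 * k + 1],
   chosen with the parity of [i] when [n] is even.  When [n] is odd, [l = n - 1]
   may have the wrong parity, which [l + n] then corrects. *)
pose l := (2 * k + ~~ odd n * odd i)%N.
have l_n : (l < n)%N by rewrite /l; lia.
have [eq_par | neq_par] := boolP (odd l == odd i).
  exists ((l - i)./2), l; split=> //; first by rewrite /l; lia.
  by congr (_ %% _)%N; rewrite /l in eq_par *; lia.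
exists ((l + n - i)./2), l; split=> //; first by rewrite /l; lia.
rewrite -[in RHS]modnDr; congr (_ %% _)%N.
by rewrite /l in neq_par *; lia.
Qed.

Lemma dihedral_class_once t h :
    t \notin nonrepresentatives -> t ^ h \notin nonrepresentatives ->
  t ^ h = t.
Proof.
case/dihedralP: t => i lt_in.
  rewrite mem_dihedral_rot // => ni; case: (dihedral_rotJ h (ltnW lt_in)) => -> //.
  have [-> | i0] := posnP i.
    by case: hD => _ _ xn _ _; rewrite subn0 xn expg0.
  (* Both [i] and [n - i] exceed [k], which forces [i = n - i]. *)
  by rewrite mem_dihedral_rot => [nni|]; [congr (x ^+ _); lia | lia].
rewrite mem_dihedral_refl // => ni; have [j -> eq_par] := dihedral_reflJ i h.
have /eqP -> : x ^+ j == x ^+ (j %% n) by rewrite dihedral_rot_eq modn_mod.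
have lt_j : (j %% n < n)%N by rewrite ltn_mod; lia.
rewrite mem_dihedral_refl // => nj; congr (x ^+ _ * y).
(* Both exponents are at least [2 * k], hence equal to [n - 1] if [n] is odd, and
   among [n - 2] and [n - 1] if [n] is even. *)
have [odd_n | even_n] := boolP (odd n); first by lia.
have : odd (j %% n) = odd i.
  by rewrite -(eq_par even_n) {2}(divn_eq j n) oddD oddM (negPf even_n) andbF.
by lia.
Qed.

End Dihedral.

Theorem theorem3p13 (m n : nat) (hm : (1 <= m)%N) (hn : (2 < n)%N)
    (F : finFieldType) (hF : #|F| = (2 ^ m)%N)
    (gT : finGroupType) (x y : gT) (hD : dihedral_presentation n x y) :
  let A := groupAlg F gT in
  let k := ((n - 1) %/ 2)%N in
  let d (b : A) : {ffun A -> A} := finfun (dmap b) in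
  exists V : {vspace {ffun A -> A}},
    [/\ forall f : {ffun A -> A}, f \in V <-> inner_derivation f,
        \dim V = (3 * k)%N
      & basis_of V
          ([seq d (gelem F (x ^+ i)%g) | i <- iota 1 k] ++
           [seq d (gelem F (x ^+ i * y)%g) | i <- iota 0 (2 * k)])].
Proof.
move=> A k d; exists (limg (linfun (@inner_der F gT))).
have := inner_der_basis F (nonrepresentatives_uniq hn hD)
  (dihedral_class_meets hn hD) (dihedral_class_once hn hD).
rewrite map_cat -!map_comp => basisV; split=> //; first exact: inner_derivationP.
rewrite (size_basis (X := in_tuple _) basisV) size_cat !size_map !size_iota.
by rewrite -/k; lia.
Qed.
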